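(* For every integer $n\ge 0$, $\mathcal{E}_n=\mathcal{A}_n$, where $\mathcal{E}_n$ is the set of extendable set partitions of $[n]$ and $\mathcal{A}_n$ is the set of atomic set partitions of $[n]$. That is, a set partition $\pi$ of $[n]$ has associated rook placement $R_\pi$ extendable in the upper-triangular board $\mathcal{T}_{n-1}$ if and only if $\pi$ cannot be written as a slash product of two nontrivial set partitions.
   Context: For a nonnegative integer $n$, $[n]=\{1,2,\ldots,n\}$ and $\Pi_n$ is the set of all set partitions of $[n]$ (into nonempty blocks). The trivial partition is the unique (empty) element of $\Pi_0$; all other partitions are nontrivial. Rooks: A rook (placement) is an $n\times n$ matrix $R$ of $0$'s and $1$'s with at most one $1$ in every row and column. A board is a subset $\mathcal{B}\subseteq[n]\times[n]$. $R$ is a rook on $\mathcal{B}$, written $R\subseteq\mathcal{B}$, if $R_{i,j}=1$ implies $(i,j)\in\mathcal{B}$. A rook $R\subseteq\mathcal{B}$ is extendable in $\mathcal{B}$ if there is an $n\times n$ permutation matrix $P$ with $P_{i,j}=R_{i,j}$ for all $(i,j)\in\mathcal{B}$. The upper-triangular board is $\mathcal{T}_n=\{(i,j)\in[n]\times[n] : i\le j\}$. Bijection: For $n\ge 1$ and $\pi\in\Pi_n$, let $R_\pi$ be the $(n-1)\times(n-1)$ rook on $\mathcal{T}_{n-1}$ with $(R_\pi)_{i,j}=1$ exactly when $i$ and $j+1$ are adjacent elements in a block of $\pi$ whose elements are listed in increasing order (i.e., $i<j+1$ lie in the same block and no element of that block lies strictly between them). The map $\pi\mapsto R_\pi$ is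 a bijection from $\Pi_n$ to rooks on $\mathcal{T}_{n-1}$. For $n=0$, there is by convention a single rook on $\mathcal{T}_{-1}$ (the unit rook); it corresponds to the empty partition and is regarded as (vacuously) extendable. For $n=1$, $R_\pi$ is the empty $0\times 0$ matrix, which is extended by the $0\times0$ permutation matrix. Define $$\mathcal{E}_n=\{\pi\in\Pi_n : R_\pi\text{ is extendable in }\mathcal{T}_{n-1}\}.$$ Atomic partitions: For a set of integers $B=\{b_1,\ldots,b_j\}$ let $B+m=\{b_1+m,\ldots,b_j+m\}$, and for a partition $\sigma=\{B_1,\ldots,B_k\}$ let $\sigma+m=\{B_1+m,\ldots,B_k+m\}$. For $\pi\in\Pi_m$ and $\sigma\in\Pi_n$, the slash product is $\pi|\sigma=\pi\cup(\sigma+m)\in\Pi_{m+n}$. A partition is atomic if it cannot be written as a slash product of two nontrivial partitions, and $\mathcal{A}_n=\{\pi\in\Pi_n : \pi\text{ is atomic}\}$. *)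

(* Defs.v *)
From mathcomp Require Import all_boot all_order all_algebra all_fingroup.

Set Implicit Arguments.
Unset Strict Implicit.
Unset Printing Implicit Defensive.

Local Open Scope nat_scope.

(** Throughout, [n] = {1, ..., n} is represented by ['I_n] = {0, ..., n-1}: the
    integer i is encoded by the ordinal i - 1. *)

(** ** Rooks *)

Definition rook n (R : 'M[nat]_n) : bool :=
  [&& [forall i, forall j, R i j \in [:: 0; 1]],
      [forall i, \sum_j R i j <= 1] & [forall j, \sum_i R i j <= 1]].

Definition rook_on n (R : 'M[nat]_n) (B : {set 'I_n * 'I_n}) : bool :=
  rook R && [forall i, forall j, (R i j == 1) ==> ((i, j) \in B)].

Definition extendable n (R : 'M[nat]_n) (B : {set 'I_n * 'I_n}) : bool :=
  rook_on R B &&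
  [exists s : 'S_n, forall i, forall j,
     ((i, j) \in B) ==> ((perm_mx s : 'M[nat]_n) i j == R i j)].

Definition upper_board n : {set 'I_n * 'I_n} := [set ij : 'I_n * 'I_n | ij.1 <= ij.2].

(** ** Set partitions and their rooks *)

Definition set_partitions n : {set {set {set 'I_n}}} :=
  [set pi | partition pi [set: 'I_n]].

Definition adjacent n (pi : {set {set 'I_n}}) (a b : 'I_n) : bool :=
  [exists B in pi,
     [&& a \in B, b \in B, a < b & [forall c in B, ~~ (a < c < b)]]].

(** [widen_ord] and [lift ord0] have values i and j + 1. After the shift by one,
    the row index i and the element j + 1 of [m+1] (1-based) are
    [widen_ord _ i] and [lift ord0 j]. *)
Definition rook_of_partition m (pi : {set {set 'I_m.+1}}) : 'M[nat]_m :=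
  \matrix_(i, j)
    nat_of_bool (adjacent pi (widen_ord (leqnSn m) i) (lift ord0 j)).

Lemma rook_of_partitionP m (pi : {set {set 'I_m.+1}}) :
  pi \in set_partitions m.+1 -> rook_on (rook_of_partition pi) (upper_board m).
Proof.
rewrite inE => /and3P[_ /trivIsetP tI _].
have uB (B C : {set 'I_m.+1}) x : B \in pi -> C \in pi -> x \in B -> x \in C ->
    B = C.
  move=> Bpi Cpi xB xC; apply/eqP/negPn/negP => nBC.
  by have /pred0Pn[] := tI _ _ Bpi Cpi nBC; exists x; rewrite /= xB.
have sum1 (f : 'I_m -> bool) :
    (forall i j, f i -> f j -> i = j) -> \sum_i (f i : nat) <= 1.
  move=> fI; case: (pickP f) => [i fi|f0]; last first.
    by rewrite big1 // => i _; rewrite f0.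
  rewrite (bigD1 i) //= fi big1 // => j nji.
  by case fj: (f j) => //; rewrite (fI j i) ?eqxx in nji.
apply/andP; split; [apply/and3P; split|].
- by apply/'forall_forallP => i j; rewrite mxE !inE; case: adjacent.
- apply/forallP => i; rewrite (eq_bigr _ (fun j _ => mxE _ _ i j)).
  apply: sum1 => j k /exists_inP[B Bpi /and4P[iB jB lij /forall_inP nj]].
  move=> /exists_inP[C Cpi /and4P[iC kC lik /forall_inP nk]].
  move: (uB _ _ _ Bpi Cpi iB iC) => eBC; subst C.
  move: (nj _ kC) (nk _ jB); rewrite lik lij /= -!leqNgt !ltnS => ? ?.
  apply/val_inj/eqP; rewrite eqn_leq.
  by rewrite -(ltnS j) -(ltnS k); apply/andP.
- apply/forallP => j; rewrite (eq_bigr _ (fun i _ => mxE _ _ i j)).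
  apply: sum1 => i k /exists_inP[B Bpi /and4P[iB jB lij /forall_inP ni]].
  move=> /exists_inP[C Cpi /and4P[kC jC lkj /forall_inP nk]].
  move: (uB _ _ _ Bpi Cpi jB jC) => eBC; subst C.
  move: (ni _ kC) (nk _ iB); rewrite lkj lij /= !andbT -!leqNgt => ? ?.
  by apply/val_inj/eqP; rewrite eqn_leq; apply/andP.
- apply/'forall_forallP => i j; rewrite mxE inE /= eqb1.
  apply/implyP => /exists_inP[B _ /and4P[_ _ + _]].
  by rewrite /= /bump add1n ltnS.
Qed.

(** For n = 0 there is no board; the empty partition is extendable by
    convention. *)
Definition extendable_partition n : {set {set 'I_n}} -> bool :=
  match n with
  | 0 => fun=> true
  | m.+1 => fun pi => extendable (rook_of_partition pi) (upper_board m)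
  end.

Definition extendable_partitions n : {set {set {set 'I_n}}} :=
  [set pi in set_partitions n | extendable_partition pi].

(** ** Atomic partitions *)

Definition slash m n (pi : {set {set 'I_m}}) (sigma : {set {set 'I_n}}) :
    {set {set 'I_(m + n)}} :=
  [set [set lshift n x | x in B] | B : {set 'I_m} in pi] :|:
  [set [set rshift m x | x in B] | B : {set 'I_n} in sigma].

Definition cast_partition m n (e : m = n) (pi : {set {set 'I_m}}) :
    {set {set 'I_n}} :=
  [set [set cast_ord e x | x in B] | B : {set 'I_m} in pi].

(** A partition of [n] is nontrivial exactly when n is nonzero. A factorization
    of pi as a slash product has factors in Pi_k and Pi_(n-k) with k <= n. *)
Definition atomic n (pi : {set {set 'I_n}}) : bool :=
  ~~ [exists k : 'I_n.+1,
      exists sigma in set_partitions k, exists tau in set_partitions (n - k),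
        [&& k != 0 :> nat, n - k != 0 &
            pi == cast_partition (subnKC (leq_ord k)) (slash sigma tau)]].

Lemma atomicP n (pi : {set {set 'I_n}}) :
  reflect
    (~ exists k l (e : k + l = n) (sigma : {set {set 'I_k}})
         (tau : {set {set 'I_l}}),
         [/\ sigma \in set_partitions k, tau \in set_partitions l,
             k != 0, l != 0 & pi = cast_partition e (slash sigma tau)])
    (atomic pi).
Proof.
apply: (iffP idP) => [/negP + [k [l [e [s [t [Ps Pt k0 l0 Epi]]]]]]|nex].
  apply; have ltkn : k < n.+1 by rewrite -e ltnS leq_addr.
  apply/existsP; exists (Ordinal ltkn); apply/exists_inP; exists s => //=.
  have el : l = n - k by rewrite -e addKn.
  subst l; apply/exists_inP; exists t => //.
  by rewrite k0 l0 Epi (eq_irrelevance e (subnKC (leq_ord (Ordinal ltkn)))) /=.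
apply/negP => /existsP[k /exists_inP[s Ps /exists_inP[t Pt /and3P[k0 l0 /eqP e]]]].
by apply: nex; exists k, (n - k), (subnKC (leq_ord k)), s, t.
Qed.

Definition atomic_partitions n : {set {set {set 'I_n}}} :=
  [set pi in set_partitions n | atomic pi].

(* Main.v *)
Require Import Defs.
From mathcomp Require Import all_boot.
From mathcomp Require Import all_fingroup all_algebra.

(** Say that a partition [pi] of [{0, ..., m}] has a cut at [k], for
    [0 < k <= m], when no block meets both [{0, ..., k-1}] and [{k, ..., m}].
    Splitting [pi] at [k] is then a slash factorization, and every slash
    factorization arises so; hence [pi] is atomic exactly when it has no cut
    ([atomic_no_cut]).  It remains to relate cuts to extensions of the rook.

    A permutation [s] extends the rook of [pi] when a row [i] that is not the
    maximum of its block goes to [s i] with [s i + 1] the successor of [i] in its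
    block, while every other row satisfies [s i < i].

    If there is a cut at [k], the successor of an element below [k] is below [k],
    so [s i + 1 < k] for all [k] rows [i < k]; these rows would be sent
    injectively into [k - 1] columns ([extendable_no_cut]).

    If there is no cut, shift columns by one and add the row [m]: an extension is
    the same as a permutation [g] of [{0, ..., m}] with [g m = 0], which maps
    every non-maximal element of a block to its successor and every block maximum
    [x <> m] to some [g x <= x].  The rotation of each block, successor on
    non-maximal elements and maximum to minimum, has all these properties except
    that it sends [m] to the minimum [b] of its own block.  If [b > 0], some block
    crosses the cut at [b]; its minimum is below [b] and its maximum [z'] is at
    least [b].  Exchanging the images of [m] and [z'] sends [z'] to [b <= z'],
    which is allowed, and [m] to the minimum of the crossing block, which is
    smaller than [b].  That block had not been touched before, so the exchange
    can be repeated with its minimum in place of [b], until [m] is sent to [0].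
    [chain_permutation] does this by induction on [b]; there the exchange for [b]
    itself comes last. *)

Set Implicit Arguments.
Unset Strict Implicit.
Unset Printing Implicit Defensive.

(** * Blocks, successors and cuts *)

Lemma partition_preimset (S T : finType) (f : S -> T) (P : {set {set T}}) :
  partition P [set: T] ->
  partition ([set f @^-1: (B : {set T}) | B in P] :\ set0) [set: S].
Proof.
case/and3P=> /eqP covP /trivIsetP tiP _; apply/and3P; split.
- rewrite eqEsubset subsetT; apply/subsetP=> x _.
  have : f x \in cover P by rewrite covP.
  case/bigcupP=> B PB fxB; apply/bigcupP; exists (f @^-1: B); last by rewrite inE.
  rewrite !inE imset_f // andbT; apply/set0Pn; exists x; by rewrite inE.
- apply/trivIsetP=> A B /setD1P[_ /imsetP[A' PA' ->]] /setD1P[_ /imsetP[B' PB' ->]].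
  move=> nAB; have nAB' : A' != B' by apply: contraNneq nAB => ->.
  by rewrite disjoints_subset -preimsetC preimsetS // -disjoints_subset tiP.
- by rewrite !inE eqxx.
Qed.

Section Blocks.

Variables (n : nat) (pi : {set {set 'I_n}}).
Hypothesis pi_part : partition pi [set: 'I_n].

Let tI : trivIset pi := partition_trivIset pi_part.

Lemma in_cover x : x \in cover pi.
Proof. by rewrite (cover_partition pi_part) inE. Qed.

Lemma block_refl x : x \in pblock pi x.
Proof. by rewrite mem_pblock in_cover. Qed.

Lemma block_eq x y : y \in pblock pi x -> pblock pi y = pblock pi x.
Proof. by move=> yx; rewrite (same_pblock tI yx). Qed.

(** In a partition, the block that witnesses adjacency can only be the block of
    the smaller element. *)
Lemma adjacentE x y :
  adjacent pi x y =
  [&& y \in pblock pi x, x < y & [forall c in pblock pi x, ~~ (x < c < y)]].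
Proof.
apply/exists_inP/idP => [[B piB /and4P[xB yB xy nB]]|/and3P[yx xy nx]].
  by rewrite (def_pblock tI piB xB) yB xy.
by exists (pblock pi x); [rewrite pblock_mem ?in_cover | rewrite block_refl yx xy].
Qed.

(** An implication is enough, because [x] and [y] can be exchanged in it; the
    symmetric form is [cutP]. *)
Definition cut (k : nat) :=
  [forall x, forall y in pblock pi x, (x < k) ==> (y < k)].

Lemma cutP k (x y : 'I_n) : cut k -> y \in pblock pi x -> (x < k) = (y < k).
Proof.
move=> /forallP kcut yx; have xy : x \in pblock pi y.
  by rewrite (block_eq yx) block_refl.
by apply/idP/idP; apply/implyP; apply: (forall_inP (kcut _)).
Qed.

Lemma crossing k : ~~ cut k ->
  exists x y : 'I_n, [/\ x < k, k <= y & y \in pblock pi x].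
Proof.
case/forallPn=> x /forall_inPn[y yx]; rewrite negb_imply -leqNgt.
by case/andP=> xk ky; exists x, y.
Qed.

Definition block_max x := [forall y in pblock pi x, y <= x].
Definition block_min x := [forall y in pblock pi x, x <= y].

Lemma block_max_uniq x y :
  y \in pblock pi x -> block_max x -> block_max y -> x = y.
Proof.
move=> yx /forall_inP/(_ _ yx) le1 /forall_inP/(_ x).
rewrite (block_eq yx) block_refl => /(_ isT) le2.
by apply/val_inj/eqP; rewrite eqn_leq le1 le2.
Qed.

Lemma block_min_uniq x y :
  y \in pblock pi x -> block_min x -> block_min y -> x = y.
Proof.
move=> yx /forall_inP/(_ _ yx) le1 /forall_inP/(_ x).
rewrite (block_eq yx) block_refl => /(_ isT) le2.
by apply/val_inj/eqP; rewrite eqn_leq le1 le2.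
Qed.

Lemma block_max_exists x : exists2 z, z \in pblock pi x & block_max z.
Proof.
case: (arg_maxnP (fun y : 'I_n => y : nat) (block_refl x)) => z zx zmax.
exists z => //; apply/forall_inP=> y; rewrite (block_eq zx); exact: zmax.
Qed.

Lemma block_min_exists x : exists2 z, z \in pblock pi x & block_min z.
Proof.
case: (arg_minnP (fun y : 'I_n => y : nat) (block_refl x)) => z zx zmin.
exists z => //; apply/forall_inP=> y; rewrite (block_eq zx); exact: zmin.
Qed.

Lemma adjacent_exists x : ~~ block_max x -> exists y, adjacent pi x y.
Proof.
case/forall_inPn=> y0 y0x; rewrite -ltnNge => lt0.
have P0 : (y0 \in pblock pi x) && (x < y0) by rewrite y0x.
case: (arg_minnP (P := fun y => (y \in pblock pi x) && (x < y))
  (fun y : 'I_n => y : nat) P0) => y /andP[yx ltxy] ymin.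
exists y; rewrite adjacentE yx ltxy; apply/forall_inP=> c cx.
by apply/negP=> /andP[xc]; rewrite ltnNge ymin // cx.
Qed.

Lemma adjacent_not_max x y : adjacent pi x y -> ~~ block_max x.
Proof.
rewrite adjacentE => /and3P[yx xy _]; apply/forall_inPn; exists y => //.
by rewrite -ltnNge.
Qed.

Lemma adjacent_not_min x y : adjacent pi x y -> ~~ block_min y.
Proof.
rewrite adjacentE => /and3P[yx xy _]; apply/forall_inPn; exists x.
  by rewrite (block_eq yx) block_refl.
by rewrite -ltnNge.
Qed.

Lemma adjacent_inj x x' y : adjacent pi x y -> adjacent pi x' y -> x = x'.
Proof.
rewrite !adjacentE => /and3P[yx xy /forall_inP nx] /and3P[yx' xy' /forall_inP nx'].
have e : pblock pi x = pblock pi x' by rewrite -(block_eq yx) (block_eq yx').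
have := nx x'; rewrite e block_refl => /(_ isT).
have := nx' x; rewrite -e block_refl => /(_ isT).
rewrite xy xy' !andbT -!leqNgt => ? ?.
by apply/val_inj/eqP; rewrite eqn_leq; apply/andP.
Qed.

Lemma adjacent_fun x y y' : adjacent pi x y -> adjacent pi x y' -> y = y'.
Proof.
rewrite !adjacentE => /and3P[yx xy /forall_inP nx] /and3P[yx' xy' /forall_inP nx'].
have := nx _ yx'; have := nx' _ yx.
rewrite xy xy' /= -!leqNgt => ? ?.
by apply/val_inj/eqP; rewrite eqn_leq; apply/andP.
Qed.

(** The cyclic rotation of every block.  Its graph is total, since an element
    that is not maximal has a successor; it is injective, since successors have
    unique predecessors and are never minimal, and a block has one maximum. *)
Lemma block_rotation :
  exists g : {perm 'I_n},
    (forall x y, adjacent pi x y -> g x = y) /\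
    (forall x b, block_max x -> block_min b -> b \in pblock pi x -> g x = b).
Proof.
pose next_rel x y := adjacent pi x y ||
  [&& block_max x, block_min y & y \in pblock pi x].
have /fin_all_exists[f fP] x : exists y, next_rel x y.
  case xmax: (block_max x).
    have [b bx bmin] := block_min_exists x.
    by exists b; rewrite /next_rel xmax bmin bx orbT.
  have [|y xy] := @adjacent_exists x; first by rewrite xmax.
  by exists y; rewrite /next_rel xy.
have f_inj : injective f.
  move=> x x' e; have := fP x; have := fP x'; rewrite -{}e /next_rel.
  move: (f x) => y.
  case/orP=> [x'y|/and3P[x'max ymin yx']] /orP[xy|/and3P[xmax ymin' yx]].
  - exact: adjacent_inj xy x'y.
  - by have := adjacent_not_min x'y; rewrite ymin'.
  - by have := adjacent_not_min xy; rewrite ymin.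
  - by apply: block_max_uniq => //; rewrite -(block_eq yx) (block_eq yx') block_refl.
exists (perm f_inj); split=> [x y xy|x b xmax bmin bx]; rewrite permE.
- case/orP: (fP x) => [|/and3P[xmax _ _]]; first by move/adjacent_fun; apply.
  by have := adjacent_not_max xy; rewrite xmax.
- case/orP: (fP x) => [/adjacent_not_max|/and3P[_ fmin fx]]; first by rewrite xmax.
  by apply: block_min_uniq => //; rewrite (block_eq fx).
Qed.

End Blocks.

(** * Cuts and slash products *)

Lemma slash_cut k l (sigma : {set {set 'I_k}}) (tau : {set {set 'I_l}}) :
  partition (slash sigma tau) [set: 'I_(k + l)] -> cut (slash sigma tau) k.
Proof.
move=> st; apply/forallP=> x; apply/forall_inP=> y yx; have := block_refl st x.
have : pblock (slash sigma tau) x \in slash sigma tau.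
  by rewrite pblock_mem // in_cover.
case/setUP=> /imsetP[B _ eB]; move: yx; rewrite {}eB.
all: move=> /imsetP[u _ ->] /imsetP[v _ ->] /=.
  by rewrite !ltn_ord.
by rewrite !ltnNge !leq_addr.
Qed.

(** The factors are the traces of the blocks on the two sides, pulled back to
    initial segments.  The cut makes each nonempty trace a whole block, so no
    block of [pi] is broken by the pull-back. *)
Lemma cut_slash k l (pi : {set {set 'I_(k + l)}}) :
  partition pi [set: 'I_(k + l)] -> cut pi k ->
  exists sigma tau, [/\ partition sigma [set: 'I_k],
    partition tau [set: 'I_l] & pi = slash sigma tau].
Proof.
move=> pi_part /(cutP pi_part) kcut.
exists ([set lshift l @^-1: (B : {set 'I_(k + l)}) | B in pi] :\ set0),
  ([set @rshift k l @^-1: (B : {set 'I_(k + l)}) | B in pi] :\ set0).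
split; try exact: partition_preimset.
have tI := partition_trivIset pi_part.
have left_block B u : B \in pi -> lshift l u \in B ->
    B = lshift l @: (lshift l @^-1: B).
  move=> piB uB; apply/setP=> y; apply/idP/imsetP=> [yB|[v + ->]]; last by rewrite inE.
  have := kcut (lshift l u) y; rewrite (def_pblock tI piB uB) => /(_ yB) /=.
  rewrite ltn_ord; case: (split_ordP y) yB => [v -> vB _|v -> _ //].
  by exists v; rewrite ?inE.
have right_block B u : B \in pi -> rshift k u \in B ->
    B = @rshift k l @: (@rshift k l @^-1: B).
  move=> piB uB; apply/setP=> y; apply/idP/imsetP=> [yB|[v + ->]]; last by rewrite inE.
  have := kcut (rshift k u) y; rewrite (def_pblock tI piB uB) => /(_ yB) /=.
  rewrite ltnNge leq_addr; case: (split_ordP y) yB => [v -> _ //|v -> vB _].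
  by exists v; rewrite ?inE.
apply/setP=> B; apply/idP/setUP => [piB|].
  have /set0Pn[x] : B != set0.
    by apply: contraTneq piB => ->; case/and3P: pi_part.
  case: (split_ordP x) => u -> uB; [left|right]; apply/imsetP.
    exists (lshift l @^-1: B); last exact: left_block uB.
    by rewrite !inE imset_f // andbT; apply/set0Pn; exists u; rewrite inE.
  exists (@rshift k l @^-1: B); last exact: right_block uB.
  by rewrite !inE imset_f // andbT; apply/set0Pn; exists u; rewrite inE.
case=> /imsetP[A /setD1P[/set0Pn[u uA] /imsetP[C piC eA]] ->].
all: move: uA; rewrite eA inE => uC.
  by rewrite -(left_block C u).
by rewrite -(right_block C u).
Qed.

Lemma cast_partition_id n (e : n = n) (pi : {set {set 'I_n}}) :
  cast_partition e pi = pi.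
Proof.
rewrite /cast_partition -[RHS]imset_id; apply: eq_imset => B.
by rewrite -[RHS]imset_id; apply: eq_imset => x; rewrite cast_ord_id.
Qed.

Lemma atomic_no_cut n (pi : {set {set 'I_n}}) :
  partition pi [set: 'I_n] ->
  reflect (forall k, 0 < k < n -> ~~ cut pi k) (atomic pi).
Proof.
move=> pi_part; apply: (iffP (atomicP pi)) => [H k /andP[k0 kn]|H].
  apply/negP=> kcut; have e := subnKC (ltnW kn).
  have l0 : n - k != 0 by rewrite -lt0n subn_gt0.
  (* Generalize [n - k] so that [n] can be replaced by [k + l]; the cast is then
     along a reflexive equation. *)
  move: (n - k) e l0 => l e l0; apply: H.
  case: _ / e pi pi_part kcut {kn} => pi pi_part kcut.
  have [sigma [tau [Ps Pt epi]]] := cut_slash pi_part kcut.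
  exists k, l, erefl, sigma, tau; rewrite cast_partition_id !inE; split=> //.
  by rewrite -lt0n.
case=> k [l [e [sigma [tau [_ _ k0 l0 epi]]]]].
case: _ / e pi pi_part H epi => pi pi_part H; rewrite cast_partition_id => epi.
have /negP[] : ~~ cut pi k.
  by apply: H; rewrite lt0n k0 -[X in X < _]addn0 ltn_add2l lt0n.
by rewrite epi; apply: slash_cut; rewrite -epi.
Qed.

(** * Cuts and extensions of the rook *)

(** Pigeonhole: an extension would map the [k] rows below [k] into the [k - 1]
    columns [j] with [j + 1 < k]. *)
Lemma extendable_no_cut m (pi : {set {set 'I_m.+1}}) k :
  partition pi [set: 'I_m.+1] ->
  extendable (rook_of_partition pi) (upper_board m) ->
  0 < k < m.+1 -> ~~ cut pi k.
Proof.
move=> pi_part /andP[_ /existsP[s /'forall_forallP sP]] /andP[k0 km].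
apply/negP=> /(cutP pi_part) kcut.
have s_lt (i : 'I_m) : i < k -> (s i).+1 < k.
  move=> ik; have [lis|lsi] := leqP i (s i); last exact: leq_ltn_trans lsi ik.
  (* On the board the extension agrees with the rook, so [i] and [s i + 1] are
     adjacent, and the cut keeps them on the same side. *)
  have := sP i (s i); rewrite inE lis /= !mxE eqxx.
  case adj: adjacent => // _; move: adj; rewrite adjacentE // => /and3P[+ _ _].
  by move/kcut; rewrite /= ik /bump /= add1n.
pose A := [set i : 'I_m | i < k]; pose B := [set j : 'I_m | j.+1 < k].
have sAB : s @: A \subset B.
  by apply/subsetP=> _ /imsetP[i + ->]; rewrite !inE; apply: s_lt.
have /proper_card : B \proper A.
  apply/properP; split; first by apply/subsetP=> j; rewrite !inE => /ltnW.
  have km1 : k.-1 < m by rewrite -ltnS prednK.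
  by exists (Ordinal km1); rewrite !inE /= prednK // ltnn.
by rewrite ltnNge -(card_imset _ (@perm_inj _ s)) subset_leq_card.
Qed.

(** The exchange argument, for an arbitrary block with minimum [b] and maximum
    [z] in place of the block of the last element.  The last clause makes the
    induction work: the permutation obtained for a block with smaller minimum is
    still the rotation on all blocks that start later, so that it sends [z] to
    [b]. *)
Lemma chain_permutation m (pi : {set {set 'I_m.+1}}) :
  partition pi [set: 'I_m.+1] ->
  (forall k, 0 < k < m.+1 -> ~~ cut pi k) ->
  forall b z, block_min pi b -> block_max pi z -> z \in pblock pi b ->
  exists g : {perm 'I_m.+1},
    [/\ g z = ord0,
        forall x y, adjacent pi x y -> g x = y,
        forall x, block_max pi x -> x != z -> g x <= x &
        forall x c, block_max pi x -> block_min pi c -> c \in pblock pi x ->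
          b < c -> g x = c].
Proof.
move=> pi_part nocut b; have [N] := ubnP (b : nat); elim: N b => // N IH b.
rewrite ltnS => leN z bmin zmax zb.
have bz : b \in pblock pi z by rewrite (block_eq pi_part zb) block_refl.
have [b0|b0] := posnP b.
  have [g [gadj gmax]] := block_rotation pi_part.
  exists g; split=> // [|x xmax _|x c xmax cmin cx _]; last exact: gmax.
    by rewrite (gmax z b) //; apply: val_inj.
  have [c cx cmin] := block_min_exists pi_part x.
  by rewrite (gmax x c) //; apply: (forall_inP xmax).
have [|x [y [xb by_ yx]]] := crossing (nocut b _); first by rewrite b0 ltn_ord.
(* The block of [x] and [y] crosses [b]: call [b'] its minimum and [z'] its
   maximum, so that [b' < b <= z']. *)
have [b' b'x b'min] := block_min_exists pi_part x.
have [z' z'x z'max] := block_max_exists pi_part x.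
have b'b : b' < b.
  apply: leq_ltn_trans xb; apply: (forall_inP b'min).
  by rewrite (block_eq pi_part b'x) block_refl.
have bz' : b <= z'.
  apply: leq_trans by_ _; apply: (forall_inP z'max).
  by rewrite (block_eq pi_part z'x).
have z'b' : z' \in pblock pi b' by rewrite (block_eq pi_part b'x).
have [g [gz' gadj gle gmin]] := IH b' (leq_trans b'b leN) z' b'min z'max z'b'.
have gz : g z = b by apply: gmin.
have zz' : z != z'.
  apply: contraTneq (b'b) => ezz'; rewrite (_ : b' = b) ?ltnn //.
  apply: (block_min_uniq pi_part) => //.
  by rewrite -(block_eq pi_part z'b') -ezz'.
(* [g] sends [z'] to [0] and [z] to [b]; exchange these two values. *)
exists (tperm z z' * g)%g; split=> [|u v uv|u umax uz|u c umax cmin cu bc].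
- by rewrite permM tpermL.
- have unmax := adjacent_not_max pi_part uv.
  rewrite permM tpermD ?(gadj u v uv) //; by apply: contraNneq unmax => <-.
- rewrite permM; case: tpermP uz => [->|->|_ /eqP uz' _]; rewrite ?eqxx ?gz //.
  exact: gle.
rewrite permM tpermD; first by apply: gmin => //; apply: ltn_trans bc.
- apply: contraTneq bc => ezu; rewrite (_ : c = b) ?ltnn //.
  by apply: (block_min_uniq pi_part) => //; rewrite (block_eq pi_part cu) -ezu.
- apply: contraTneq (ltn_trans b'b bc) => ezu; rewrite (_ : c = b') ?ltnn //.
  apply: (block_min_uniq pi_part) => //.
  by rewrite (block_eq pi_part cu) -ezu (block_eq pi_part z'x).
Qed.

(** The permutation of rows is [g] from [chain_permutation] for the block of the
    last element, read as a map from elements [i] other than the last to elements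
    [j + 1] other than [0]. *)
Lemma no_cut_extendable m (pi : {set {set 'I_m.+1}}) :
  partition pi [set: 'I_m.+1] ->
  (forall k, 0 < k < m.+1 -> ~~ cut pi k) ->
  extendable (rook_of_partition pi) (upper_board m).
Proof.
move=> pi_part nocut; apply/andP; split.
  by apply: rook_of_partitionP; rewrite inE.
have [b bmax bmin] := block_min_exists pi_part ord_max.
have zmax : block_max pi ord_max by apply/forall_inP=> y _; apply: leq_ord.
have zb : ord_max \in pblock pi b.
  by rewrite (block_eq pi_part bmax) block_refl.
have [g [gz gadj gle _]] := chain_permutation pi_part nocut bmin zmax zb.
pose w := widen_ord (leqnSn m).
have /fin_all_exists[f fE] (i : 'I_m) : exists j, g (w i) = lift ord0 j.
  case: (unliftP ord0 (g (w i))) => [j ->|]; first by exists j.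
  rewrite -gz => /perm_inj/(congr1 val) /= im.
  by have := ltn_ord i; rewrite im ltnn.
have f_inj : injective f.
  move=> i i' e; apply/val_inj; suff: w i = w i' by move/(congr1 val).
  by apply: (@perm_inj _ g); rewrite !fE e.
apply/existsP; exists (perm f_inj); apply/'forall_forallP=> i j.
rewrite inE /= !mxE permE; apply/implyP=> ij.
suff -> : (f i == j) = adjacent pi (w i) (lift ord0 j) by case: adjacent.
(* If [g] sends [i] strictly up then [i] is not the maximum of its block, so
   that [g i] is the successor of [i]. *)
rewrite -(inj_eq (@lift_inj _ ord0)) -fE; apply/eqP/idP => [gij|]; last exact: gadj.
have [|y wy] := @adjacent_exists _ _ pi_part (w i); last by rewrite -gij (gadj _ _ wy).
apply: contraTN ij => wmax; rewrite -ltnNge.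
have /gle := wmax; rewrite gij /= /bump add1n; apply.
by rewrite -val_eqE /= neq_ltn ltn_ord.
Qed.

Theorem theorem1p1 (n : nat) :
  extendable_partitions n = atomic_partitions n.
Proof.
apply/setP=> pi; rewrite !in_set; apply: andb_id2l => pi_part.
apply/idP/(atomic_no_cut pi_part).
  case: n pi pi_part => [|m] pi pi_part ext k; first by case: k.
  exact: extendable_no_cut.
by case: n pi pi_part => // m pi pi_part; apply: no_cut_extendable.
Qed.
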